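(* Let $\mathcal{L}$ be a finite congruence-uniform lattice. The core label order $\mathrm{CLO}(\mathcal{L})$ is a meet-semilattice if and only if $\mathcal{L}$ has the intersection property.
   Context: For a finite lattice $\mathcal{L}=(L,\leq)$, $\mathcal{J}(\mathcal{L})$ denotes the set of join-irreducible elements; each $j\in\mathcal{J}(\mathcal{L})$ has a unique lower cover $j_*$. For a cover relation $u\lessdot v$, $\mathrm{cg}(u,v)$ is the finest lattice congruence in which $u,v$ are equivalent, and $\mathrm{cg}(j)=\mathrm{cg}(j_*,j)$; the join-irreducible elements of the congruence lattice are exactly the $\mathrm{cg}(j)$. A finite lattice is congruence-uniform if $j\mapsto\mathrm{cg}(j)$ is a bijection from $\mathcal{J}(\mathcal{L})$ onto the join-irreducible congruences, for both $\mathcal{L}$ and its dual. For a cover $u\lessdot v$, $j_{\mathrm{cg}(u,v)}$ denotes the unique $j\in\mathcal{J}(\mathcal{L})$ with $\mathrm{cg}(j)=\mathrm{cg}(u,v)$. The nucleus of $x$ is $x_\downarrow=\bigwedge\{y\mid y\lessdot x\}$; the core label set is $\Psi(x)=\{j_{\mathrm{cg}(u,v)}\mid x_\downarrow\le u\lessdot v\le x\}$ (empty for $x=\hat0$). The core label order is $\mathrm{CLO}(\mathcal{L})=(L,\sqsubseteq)$ with $x\sqsubseteq y$ iff $\Psi(x)\subseteq\Psi(y)$. $\mathcal{L}$ has the intersection property if for all $x,y\in L$ there exists $z\in L$ with $\Psi(x)\cap\Psi(y)=\Psi(z)$. A meet-semilattice is a poset in which any two elements have a greatest lower bound. *)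

(* Defs.v *)
From mathcomp Require Import all_boot all_order.

Set Implicit Arguments.
Unset Strict Implicit.
Unset Printing Implicit Defensive.

Import Order.TTheory.
Local Open Scope order_scope.

Section Lattice.
Context {d : Order.disp_t} {L : finTBLatticeType d}.
Implicit Types (x y u v w j : L) (A B C : {set L * L}).

Definition covers u v : bool := (u < v) && [forall w, ~~ (u < w < v)].

Definition join_irreducible j : bool :=
  (j != \bot) &&
  [forall x, forall y, (j == x `|` y) ==> (j == x) || (j == y)].

(* j_*, the unique lower cover of j when j is join-irreducible (see
   [lower_starP]); the value is irrelevant otherwise. *)
Definition lower_star j : L := odflt j [pick u | covers u j].

(* Congruences are represented by their graphs; refinement of congruences is
   then inclusion of sets. *)
Definition congruence C : bool :=
  [&& [forall x, (x, x) \in C],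
      [forall x, forall y, ((x, y) \in C) ==> ((y, x) \in C)],
      [forall x, forall y, forall w,
         ((x, y) \in C) && ((y, w) \in C) ==> ((x, w) \in C)] &
      [forall x, forall y, forall u, forall v,
         ((x, y) \in C) && ((u, v) \in C) ==>
         ((x `&` u, y `&` v) \in C) && ((x `|` u, y `|` v) \in C)]].

Definition con_gen A : {set L * L} :=
  \bigcap_(C : {set L * L} | congruence C && (A \subset C)) C.

Definition con_bot : {set L * L} := [set p | p.1 == p.2].
Definition con_join A B : {set L * L} := con_gen (A :|: B).

Definition con_join_irreducible C : bool :=
  [&& congruence C, C != con_bot &
      [forall A : {set L * L}, forall B : {set L * L},
         [&& congruence A, congruence B & C == con_join A B] ==>
         (C == A) || (C == B)]].

Definition cg u v : {set L * L} := con_gen [set (u, v)].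
Definition cgj j : {set L * L} := cg (lower_star j) j.

Definition cgj_bijective : Prop :=
  [/\ forall j, join_irreducible j -> con_join_irreducible (cgj j),
      {in join_irreducible &, injective cgj} &
      forall C, con_join_irreducible C ->
        exists2 j, join_irreducible j & cgj j = C].

(* j = j_{cg(u, v)}; at most one such j exists when [cgj] is injective on the
   join-irreducible elements. *)
Definition cover_label u v j : bool :=
  join_irreducible j && (cgj j == cg u v).

Definition nucleus x : L := \meet_(y | covers y x) y.

(* For x = \bot the nucleus is the empty meet \top, but no v <= \bot covers
   anything, so the core label set is empty (see [core_labels_bot]). *)
Definition core_labels x : {set L} :=
  [set j | [exists u, exists v,
     [&& nucleus x <= u, covers u v, v <= x & cover_label u v j]]].

Definition core_label_order : rel L :=
  fun x y => core_labels x \subset core_labels y.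

Lemma lower_starP j : join_irreducible j ->
  forall y, covers y j = (y == lower_star j).
Proof.
move=> /andP[j0 /forallP jirr].
have uniq_cov u v : covers u j -> covers v j -> u = v.
  move=> /andP[uj /forallP mu] /andP[vj /forallP mv].
  have uvj : u `|` v < j.
    rewrite lt_neqAle leUx !ltW // !andbT; apply/eqP => e.
    have /forallP/(_ v) := jirr u; rewrite e eqxx /=.
    by rewrite (gt_eqF uj) (gt_eqF vj).
  have := mu (u `|` v); rewrite uvj andbT lt_neqAle leUl andbT negbK => /eqP uE.
  have := mv (u `|` v); rewrite uvj andbT lt_neqAle leUr andbT negbK => /eqP vE.
  by rewrite {1}uE -vE.
rewrite /lower_star; case: pickP => /= [u cu y|no].
  apply/idP/eqP => [cy|-> //]; exact: uniq_cov.
have b0 : \bot < j by rewrite lt0x.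
pose down u := #|[set w | w <= u]|.
have [u uj mu] := @arg_maxnP L \bot (fun u => u < j) down b0.
have := no u; rewrite /covers uj /= => /negbT.
rewrite negb_forall => /existsP[w]; rewrite negbK => /andP[uw wj].
have /negP[] : ~~ (down u >= down w)%N; last exact: mu.
rewrite -ltnNge; apply: proper_card; apply/properP; split.
  by apply/subsetP => t; rewrite !inE => /le_trans; apply; apply: ltW.
by exists w; rewrite !inE ?lexx // (lt_geF uw).
Qed.

Lemma congruenceP C : reflect
  [/\ forall x, (x, x) \in C,
      forall x y, (x, y) \in C -> (y, x) \in C,
      forall x y w, (x, y) \in C -> (y, w) \in C -> (x, w) \in C &
      forall x y u v, (x, y) \in C -> (u, v) \in C ->
        (x `&` u, y `&` v) \in C /\ (x `|` u, y `|` v) \in C]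
  (congruence C).
Proof.
apply: (iffP and4P) => [[r s t c]|[r s t c]]; split.
- by move=> x; move/forallP: r; apply.
- by move=> x y; move/'forall_'forall_implyP: s; apply.
- move=> x y w xy yw.
  move/forallP/(_ x)/forallP/(_ y)/forallP/(_ w)/implyP: t; apply.
  by rewrite xy.
- move=> x y u v xy uv; apply/andP.
  move/forallP/(_ x)/forallP/(_ y)/forallP/(_ u)/forallP/(_ v)/implyP: c.
  by apply; rewrite xy.
- exact/forallP.
- by apply/'forall_'forall_implyP.
- apply/forallP => x; apply/forallP => y; apply/forallP => w.
  by apply/implyP => /andP[]; apply: t.
- apply/forallP => x; apply/forallP => y; apply/forallP => u.
  apply/forallP => v; apply/implyP => /andP[xy uv]; apply/andP; exact: c.
Qed.

Lemma con_genP A :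
  [/\ congruence (con_gen A), A \subset con_gen A &
      forall C, congruence C -> A \subset C -> con_gen A \subset C].
Proof.
split; last by move=> C cC AC; apply: bigcap_inf; rewrite cC.
  apply/congruenceP; split.
  - by move=> x; apply/bigcapP => C /andP[/congruenceP[r _ _ _] _]; apply: r.
  - move=> x y /bigcapP xy; apply/bigcapP => C hC.
    by have /andP[/congruenceP[_ s _ _] _] := hC; apply: s; apply: xy.
  - move=> x y w /bigcapP xy /bigcapP yw; apply/bigcapP => C hC.
    have /andP[/congruenceP[_ _ t _] _] := hC.
    by apply: t (xy _ hC) (yw _ hC).
  - move=> x y u v /bigcapP xy /bigcapP uv.
    by split; apply/bigcapP => C hC;
      have /andP[/congruenceP[_ _ _ c] _] := hC;
      have [] := c _ _ _ _ (xy _ hC) (uv _ hC).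
by apply/bigcapsP => C /andP[].
Qed.

Lemma core_labels_bot : core_labels \bot = set0.
Proof.
apply/setP => j; rewrite !inE; apply/negbTE/existsP => -[u /existsP[v]].
case/and4P => _ /andP[uv _] /(lt_le_trans uv); by rewrite ltx0.
Qed.

End Lattice.

Definition congruence_uniform (d : Order.disp_t) (L : finTBLatticeType d) :
  Prop := @cgj_bijective d L /\ @cgj_bijective _ L^d.

Definition intersection_property (d : Order.disp_t) (L : finTBLatticeType d) :
  Prop :=
  forall x y : L, exists z : L, core_labels x :&: core_labels y = core_labels z.

Definition partial_order (T : Type) (r : rel T) : Prop :=
  [/\ reflexive r, antisymmetric r & transitive r].

Definition is_glb (T : Type) (r : rel T) (x y z : T) : Prop :=
  [/\ r z x, r z y & forall w, r w x -> r w y -> r w z].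

Definition meet_semilattice (T : Type) (r : rel T) : Prop :=
  partial_order r /\ forall x y, exists z, is_glb r x y z.

(* Main.v *)
Require Import Defs.
From mathcomp Require Import all_boot all_order.

(** For a cover [u < v], any [j] that is minimal among the elements not below
    [u] and lies below [v] is join-irreducible, and the interval [j_* < j]
    transposes to [u < v].  By injectivity of [cgj] this [j] is the label of
    the cover; so the label of [u < v] lies below [v] but not below [u].  It
    follows that every element is the join of its core labels, whence the core
    label order is the inclusion order of an injective family of sets.  As
    [core_labels j = [set j]] for [j] join-irreducible, this family contains
    the singleton of each label; a greatest lower bound of two members then
    contains every label common to both, so it is their intersection. *)

Set Implicit Arguments.
Unset Strict Implicit.
Unset Printing Implicit Defensive.

Import Order.TTheory.
Local Open Scope order_scope.

Section InclusionOrder.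
Variables (T : Type) (U : finType) (f : T -> {set U}).
Implicit Types (x y z : T).

Local Notation inclusion := (fun x y => f x \subset f y).

Lemma inclusion_partial_order : injective f -> partial_order inclusion.
Proof.
move=> f_inj; split=> [x|x y|y x z]; first exact: subxx.
  by rewrite -eqEsubset => /eqP/f_inj.
exact: subset_trans.
Qed.

Hypothesis f_singleton :
  forall x i, i \in f x -> exists t, f t = [set i].

Lemma is_glb_inclusion x y z :
  is_glb inclusion x y z <-> f x :&: f y = f z.
Proof.
split=> [[zx zy glb]|xyz].
  apply/eqP; rewrite eqEsubset subsetI zx zy !andbT.
  apply/subsetP => i /setIP[ix iy]; have [t ft] := f_singleton ix.
  by have := glb t; rewrite ft !sub1set; apply.
rewrite /is_glb -xyz subsetIl subsetIr; split=> // w wx wy.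
by rewrite subsetI wx.
Qed.

Lemma inclusion_meet_semilattice : injective f ->
  meet_semilattice inclusion <->
  forall x y, exists z, f x :&: f y = f z.
Proof.
move=> f_inj; split=> [[_ glb] x y|meet_closed].
  by have [z /is_glb_inclusion] := glb x y; exists z.
split=> [|x y]; first exact: inclusion_partial_order.
by have [z /is_glb_inclusion] := meet_closed x y; exists z.
Qed.

End InclusionOrder.

Lemma exists_minimal_le (d : Order.disp_t) (T : finPOrderType d)
  (P : pred T) x :
  P x -> exists m, [/\ P m, m <= x & forall w, w < m -> ~~ P w].
Proof.
move=> Px; pose down_card u := #|[pred t : T | t <= u]|.
have PxP : P x && (x <= x) by rewrite Px lexx.
have [m /andP[Pm mx] min] :=
  @arg_minnP T x (fun w => P w && (w <= x)) down_card PxP.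
exists m; split=> // w wm; apply/negP => Pw.
have /min : P w && (w <= x) by rewrite Pw (le_trans (ltW wm) mx).
apply/negP; rewrite -ltnNge; apply/proper_card/properP; split.
  by apply/subsetP => t; rewrite !inE => /le_trans; apply; apply: ltW.
by exists m; rewrite !inE ?lexx // (lt_geF wm).
Qed.

Lemma exists_maximal_ge (d : Order.disp_t) (T : finPOrderType d)
  (P : pred T) x :
  P x -> exists m, [/\ P m, x <= m & forall w, m < w -> ~~ P w].
Proof.
move=> Px; have [m [Pm xm max]] := @exists_minimal_le _ T^d P x Px.
by exists m.
Qed.

Section CoreLabels.
Context {d : Order.disp_t} {L : finTBLatticeType d}.
Implicit Types (x y u v w j k : L) (C : {set L * L}).

Lemma covers_interval a b u v : covers a b ->
  a <= u -> u < v -> v <= b -> u = a /\ v = b.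
Proof.
case/andP=> _ /forallP between au uv vb; split; apply/eqP.
  have := between u; rewrite (lt_le_trans uv vb) andbT.
  by rewrite lt_neqAle au andbT negbK eq_sym.
by have := between v; rewrite (le_lt_trans au uv) lt_neqAle vb andbT negbK.
Qed.

Lemma covers_join u v j : covers u v -> j <= v -> ~~ (j <= u) -> j `|` u = v.
Proof.
move=> cuv jv ju; have [] // := covers_interval cuv (lexx u) (v := j `|` u).
  by rewrite lt_neqAle leUr eq_sym eq_joinr ju.
by rewrite leUx jv ltW //; case/andP: cuv.
Qed.

Lemma exists_lower_cover u x : u < x -> exists2 w, u <= w & covers w x.
Proof.
move/(@exists_maximal_ge _ L (< x)) => [w [/= wx uw max]]; exists w => //.
rewrite /covers wx; apply/forallP => t; rewrite negb_and -implybE.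
exact/implyP/max.
Qed.

Lemma lower_star_covers j : join_irreducible j -> covers (lower_star j) j.
Proof. by move=> j_irr; rewrite lower_starP. Qed.

Lemma cg_congruence u v : congruence (cg u v).
Proof. by case: (con_genP [set (u, v)]). Qed.

Lemma cg_subset u v C : congruence C -> (cg u v \subset C) = ((u, v) \in C).
Proof.
have [_ gen_sub gen_min] := con_genP [set (u, v)].
move=> C_con; apply/idP/idP => [/(subset_trans gen_sub)|]; rewrite -sub1set //.
exact: gen_min.
Qed.

Lemma mem_cg u v : (u, v) \in cg u v.
Proof. by rewrite -cg_subset ?cg_congruence. Qed.

Lemma cg_meet_join u j : cg (j `&` u) j = cg u (j `|` u).
Proof.
apply/eqP; rewrite eqEsubset !cg_subset ?cg_congruence //; apply/andP; split.
  have /congruenceP[refl _ _ compat] := cg_congruence u (j `|` u).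
  have [+ _] := compat _ _ _ _ (refl j) (mem_cg u (j `|` u)).
  by rewrite joinKI.
have /congruenceP[refl _ _ compat] := cg_congruence (j `&` u) j.
have [_] := compat _ _ _ _ (mem_cg (j `&` u) j) (refl u).
by rewrite (join_r (leIr u j)).
Qed.

Definition minimal_nle u j : Prop :=
  ~~ (j <= u) /\ forall w, w < j -> w <= u.

Lemma exists_minimal_nle u v :
  ~~ (v <= u) -> exists2 j, minimal_nle u j & j <= v.
Proof.
move/(@exists_minimal_le _ L (fun w => ~~ (w <= u))) => [j [ju jv min]].
by exists j => //; split=> // w /min; rewrite negbK.
Qed.

Lemma minimal_nle_join_irreducible u j :
  minimal_nle u j -> join_irreducible j.
Proof.
move=> [ju below]; apply/andP; split.
  by apply: contraNneq ju => ->; apply: le0x.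
apply/'forall_'forall_implyP => a b /eqP jab.
apply: contraNT ju; rewrite negb_or => /andP[ja jb]; rewrite jab leUx.
by rewrite !below // lt_neqAle eq_sym ?ja ?jb jab ?leUl ?leUr.
Qed.

Lemma minimal_nle_lower_star u j : minimal_nle u j -> lower_star j = j `&` u.
Proof.
move=> ju_min; apply/esym/eqP.
rewrite -lower_starP ?(minimal_nle_join_irreducible ju_min) //.
have [ju below] := ju_min.
rewrite /covers lt_neqAle eq_meetl ju leIl; apply/forallP => w.
apply/negP => /andP[juw wj].
by move: (lt_geF juw); rewrite lexI (ltW wj) below.
Qed.

Lemma minimal_nle_cover_label u v j :
  covers u v -> j <= v -> minimal_nle u j -> cover_label u v j.
Proof.
move=> cuv jv ju_min; have [ju _] := ju_min.
rewrite /cover_label (minimal_nle_join_irreducible ju_min) /cgj.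
rewrite (minimal_nle_lower_star ju_min) cg_meet_join.
by rewrite (covers_join cuv jv ju) eqxx.
Qed.

Lemma exists_cover_label u v :
  covers u v -> exists j, [/\ cover_label u v j, j <= v & ~~ (j <= u)].
Proof.
move=> cuv; have /andP[/lt_geF/negbT/exists_minimal_nle[j ju_min jv] _] := cuv.
by exists j; split=> //; [apply: minimal_nle_cover_label | case: ju_min].
Qed.

Lemma cover_label_lower_star j :
  join_irreducible j -> cover_label (lower_star j) j j.
Proof. by rewrite /cover_label eqxx andbT. Qed.

Lemma core_labelsP x j : reflect
  (exists u v, [/\ nucleus x <= u, covers u v, v <= x & cover_label u v j])
  (j \in core_labels x).
Proof.
rewrite inE; apply: (iffP existsP) => [[u /existsP[v /and4P]]|[u [v uv]]].
  by exists u, v.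
by exists u; apply/existsP; exists v; apply/and4P.
Qed.

Lemma join_irreducible_core_label x j :
  j \in core_labels x -> join_irreducible j.
Proof. by case/core_labelsP=> u [v [_ _ _ /andP[]]]. Qed.

Lemma exists_core_label_nle x y :
  ~~ (x <= y) -> exists2 j, j \in core_labels x & ~~ (j <= y).
Proof.
move=> xy; have xyx : x `&` y < x by rewrite lt_neqAle eq_meetl xy leIl.
have [w xyw cwx] := exists_lower_cover xyx.
have [j [lj jx jw]] := exists_cover_label cwx.
exists j; last by apply: contraNN jw => jy; rewrite (le_trans _ xyw) ?lexI ?jx.
by apply/core_labelsP; exists w, x; split=> //; apply: meets_inf.
Qed.

Lemma nucleus_join_irreducible j :
  join_irreducible j -> nucleus j = lower_star j.
Proof.
by move=> j_irr; rewrite /nucleus (big_pred1 _ (lower_starP j_irr)).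
Qed.

Hypothesis cgj_inj : {in @join_irreducible d L &, injective cgj}.

Lemma cover_label_uniq u v j k :
  cover_label u v j -> cover_label u v k -> j = k.
Proof.
move=> /andP[j_irr /eqP cgj_uv] /andP[k_irr /eqP cgk_uv].
by apply: cgj_inj => //; rewrite cgj_uv.
Qed.

Lemma cover_label_le u v j : covers u v -> cover_label u v j -> j <= v.
Proof.
by move=> /exists_cover_label[k [lk kv _]] lj; rewrite (cover_label_uniq lj lk).
Qed.

Lemma core_labels_le x j : j \in core_labels x -> j <= x.
Proof.
case/core_labelsP=> u [v [_ cuv vx lj]].
exact: le_trans (cover_label_le cuv lj) vx.
Qed.

Lemma join_core_labels x : \join_(j in core_labels x) j = x.
Proof.
apply/le_anti/andP; split; first by apply/joinsP => j /core_labels_le.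
apply/negPn/negP => /exists_core_label_nle[j jx /negP[]].
exact: joins_sup.
Qed.

Lemma core_labels_inj : injective (@core_labels d L).
Proof.
by move=> x y xy; rewrite -[x]join_core_labels xy join_core_labels.
Qed.

Lemma core_labels_join_irreducible j :
  join_irreducible j -> core_labels j = [set j].
Proof.
move=> j_irr; have cj := lower_star_covers j_irr.
have lj := cover_label_lower_star j_irr.
apply/setP => k; rewrite in_set1.
apply/core_labelsP/eqP => [[u [v [nuc_u /andP[uv _] vj lk]]]|->].
  rewrite nucleus_join_irreducible // in nuc_u.
  have [uE vE] := covers_interval cj nuc_u uv vj.
  by rewrite uE vE in lk; apply: cover_label_uniq lk lj.
by exists (lower_star j), j; rewrite nucleus_join_irreducible.
Qed.

End CoreLabels.

Theorem theorem4p8 (d : Order.disp_t) (L : finTBLatticeType d)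
  (hL : congruence_uniform L) :
  meet_semilattice (@core_label_order d L) <-> intersection_property L.
Proof.
have [[_ cgj_inj _] _] := hL.
apply: inclusion_meet_semilattice; last exact: core_labels_inj.
move=> x j /join_irreducible_core_label j_irr.
by exists j; apply: core_labels_join_irreducible.
Qed.
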